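(* Let $\alpha,\beta$ be integers such that $\alpha\geq 0$. Then there exists a connected equitable biregular $2$-walk $(\alpha,\beta)$-linear graph if and only if $\alpha^{2}+4\beta>4$.
   Context: All graphs are finite and simple. Let $G$ be a graph with $(0,1)$-adjacency matrix $A$, let $\mathbf{j}$ be the all-ones vector, and let $\mathbf{d}:=A\mathbf{j}$ be the vector of valencies (degrees). For real numbers $\alpha,\beta$, the graph $G$ is called $2$-walk $(\alpha,\beta)$-linear if $G$ is not regular and $A\mathbf{d}=\alpha\mathbf{d}+\beta\mathbf{j}$. A graph is biregular if it has exactly two distinct valencies. If $G$ has distinct valencies $k_1,\dots,k_t$, its valency partition is the partition of the vertex set into the sets $V_i=\{v\in V(G): d_v=k_i\}$, $1\le i\le t$. A partition $\{\pi_1,\dots,\pi_t\}$ of the vertex set is equitable if for all $i,j$ the number of neighbours in $\pi_j$ of a vertex $x\in\pi_i$ does not depend on the choice of $x$ in $\pi_i$. A graph is equitable if its valency partition is equitable; an equitable biregular graph is a biregular graph whose valency partition is equitable. *)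

(* Defs.v *)
From mathcomp Require Import all_boot all_order all_algebra.
From mathcomp Require Import reals.

Set Implicit Arguments.
Unset Strict Implicit.
Unset Printing Implicit Defensive.

Import Order.TTheory GRing.Theory Num.Theory.
Local Open Scope ring_scope.

Record sgraph := SGraph {
  vertex :> finType;
  adj : rel vertex;
  adj_sym : symmetric adj;
  adj_irr : irreflexive adj
}.

Definition neighbours (G : sgraph) (x : G) : {set G} := [set y | adj x y].

Definition valency (G : sgraph) (x : G) : nat := #|neighbours x|.

Definition regular (G : sgraph) : Prop :=
  exists k : nat, forall x : G, valency x = k.

Definition valencies (G : sgraph) : seq nat :=
  undup [seq valency x | x : G].

Definition biregular (G : sgraph) : Prop := size (valencies G) = 2%N.

Definition connected (G : sgraph) : Prop :=
  (0 < #|G|)%N /\ forall x y : G, connect (@adj G) x y.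

Definition equitable_partition (G : sgraph) (P : {set {set G}}) : Prop :=
  partition P [set: G] /\
  forall X Y : {set G}, X \in P -> Y \in P ->
  forall x x' : G, x \in X -> x' \in X ->
    #|neighbours x :&: Y| = #|neighbours x' :&: Y|.

Definition valency_partition (G : sgraph) : {set {set G}} :=
  preim_partition (@valency G) [set: G].

Definition equitable (G : sgraph) : Prop :=
  equitable_partition (valency_partition G).

Definition adjmx (R : realType) (G : sgraph) : 'M[R]_#|G| :=
  \matrix_(i, j) (adj (enum_val i) (enum_val j))%:R.

Definition allones (R : realType) (G : sgraph) : 'cV[R]_#|G| := const_mx 1.

Definition valency_vec (R : realType) (G : sgraph) : 'cV[R]_#|G| :=
  adjmx R G *m allones R G.

Definition two_walk_linear (R : realType) (alpha beta : R) (G : sgraph) : Prop :=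
  ~ regular G /\
  adjmx R G *m valency_vec R G =
    alpha *: valency_vec R G + beta *: allones R G.

(* Main.v *)
Require Import Defs.
From mathcomp Require Import all_boot all_order all_algebra.
From mathcomp Require Import reals.
From mathcomp Require Import zify ring.

Set Implicit Arguments.
Unset Strict Implicit.
Unset Printing Implicit Defensive.

Import Order.TTheory GRing.Theory Num.Theory.
Local Open Scope ring_scope.

(** If the valency partition has quotient matrix [[a, b], [c, d]], the
    two-walk condition says that this matrix [Q] satisfies
    [Q^2 = alpha Q + beta] on the independent vectors [j] and [Q j], hence
    [alpha = a + d], [beta = b c - a d] and
    [alpha^2 + 4 beta = (a - d)^2 + 4 b c].  Connectedness gives [b, c >= 1],
    so this is at least 4, with equality only for [a = d] and [b = c = 1],
    which would make the graph regular.  Conversely one can always solve with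
    [b = 1], [c = m] and [d = a] (if [alpha] is even) or [d = a + 1] (if
    [alpha] is odd): take a connected [d]-regular graph on [T], [m] disjoint
    copies of an [a]-regular graph on the same [T], and join every vertex of
    [T] to its [m] copies.  Complete graphs on [d + 1] vertices serve in the
    even case; in the odd case use [K_(d, d)] and two disjoint [K_d]. *)

(** * Valency classes, equitability and biregularity of a single graph *)

Section SimpleGraphs.
Variable G : sgraph.
Implicit Types (x y : G) (X Y : {set G}) (k : nat).

Definition valency_class k : {set G} := [set y | valency y == k].

Lemma in_valency_partition x :
  valency_class (valency x) \in valency_partition G.
Proof.
apply/imsetP; exists x => //.
by apply/setP => y; rewrite !inE eq_sym.
Qed.

Lemma valency_partitionP X :
  X \in valency_partition G -> exists x, X = valency_class (valency x).
Proof.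
case/imsetP => x _ ->; exists x.
by apply/setP => y; rewrite !inE eq_sym.
Qed.

Lemma equitableP :
  equitable G <->
  forall x x' y, valency x = valency x' ->
    #|neighbours x :&: valency_class (valency y)| =
    #|neighbours x' :&: valency_class (valency y)|.
Proof.
split=> [[_ eqG] x x' y vxx'|eqG].
  by apply: (eqG (valency_class (valency x))); rewrite ?in_valency_partition //
     inE ?vxx'.
split; first exact: preim_partitionP.
move=> X Y /valency_partitionP[x0 ->] /valency_partitionP[y ->] x x'.
by rewrite !inE => /eqP vx /eqP vx'; apply: eqG; rewrite vx vx'.
Qed.

Lemma biregularP :
  biregular G <->
  exists x1 x2, valency x1 != valency x2 /\
    forall x, valency x = valency x1 \/ valency x = valency x2.
Proof.
have memG k : reflect (exists x, valency x = k) (k \in valencies G).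
  rewrite mem_undup; apply: (iffP mapP) => [[x _ ->]|[x <-]]; exists x => //.
  by rewrite mem_enum.
have uniqG : uniq (valencies G) by exact: undup_uniq.
split=> [|[x1 [x2 [neq12 all12]]]].
  rewrite /biregular; case: (valencies G) memG uniqG => [|k1 [|k2 [|]]] // memG.
  rewrite /= inE andbT => neq12 _.
  have /memG[x1 vx1] : k1 \in [:: k1; k2] by rewrite inE eqxx.
  have /memG[x2 vx2] : k2 \in [:: k1; k2] by rewrite !inE eqxx orbT.
  exists x1, x2; rewrite vx1 vx2; split=> // x.
  have : valency x \in [:: k1; k2] by apply/memG; exists x.
  by rewrite !inE => /orP[] /eqP; [left | right].
have uniq12 : uniq [:: valency x1; valency x2] by rewrite /= inE neq12.
apply: (perm_size (s2 := [:: valency x1; valency x2])).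
apply: uniq_perm => // k; rewrite !inE; apply/memG/idP.
  by case=> x <-; case: (all12 x) => ->; rewrite eqxx ?orbT.
by case/orP=> /eqP->; [exists x1 | exists x2].
Qed.

(** Otherwise the class of [x1] would be closed under adjacency, hence under [connect], and would
    contain [x2]. *)
Lemma connected_class_edge x1 x2 :
    connected G -> valency x1 != valency x2 ->
  exists x y, [/\ adj x y, valency x = valency x1 & valency y != valency x1].
Proof.
case=> _ connG neq12.
case: (boolP [forall x : G, forall y : G, adj x y ==>
  (valency x == valency x1) ==> (valency y == valency x1)]) => [clos|].
  have clos1 : closed (@adj G) (valency_class (valency x1)).
    apply: (intro_closed (sym_connect_sym (@adj_sym G))) => x y xy.
    by rewrite !inE; have /forallP/(_ y)/implyP/(_ xy)/implyP := forallP clos x.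
  have := closed_connect clos1 (connG x1 x2).
  by rewrite !inE eqxx eq_sym (negPf neq12).
rewrite negb_forall => /existsP[x]; rewrite negb_forall => /existsP[y].
by rewrite !negb_imply => /and3P[xy /eqP vx vy]; exists x, y.
Qed.

(** Stated over a semiring to serve twice: with [F] constantly 1 over [nat] it splits a valency,
    with [F] the embedding into [R] it evaluates the walk condition. *)
Lemma sum_neighbours_biregular (S : pzSemiRingType) (F : nat -> S) k1 k2 x :
    k1 != k2 -> (forall y, valency y = k1 \/ valency y = k2) ->
  \sum_(y in neighbours x) F (valency y) =
    #|neighbours x :&: valency_class k1|%:R * F k1 +
    #|neighbours x :&: valency_class k2|%:R * F k2.
Proof.
move=> neq12 all12; rewrite (big_setID (valency_class k1)) /=.
have -> : neighbours x :\: valency_class k1 = neighbours x :&: valency_class k2.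
  apply/setP => y; rewrite !inE andbC; congr andb.
  by case: (all12 y) => ->; rewrite eqxx ?(negPf neq12) // eq_sym (negPf neq12).
by congr (_ + _); rewrite mulr_natl -sumr_const; apply: eq_bigr => y;
  rewrite !inE => /andP[_ /eqP->].
Qed.

(** Turns the counts of [equitableP] into sums over neighbours. *)
Lemma card_neighbours_class x k :
  #|neighbours x :&: valency_class k| =
    (\sum_(y in neighbours x) (valency y == k))%N.
Proof.
rewrite -sum1_card big_mkcond [RHS]big_mkcond /=; apply: eq_bigr => y _.
by rewrite !inE; case: (adj x y) (valency y == k) => [] [].
Qed.

End SimpleGraphs.

(** * The walk condition vertex by vertex, and necessity of the inequality *)

Lemma two_walk_linearP (R : realType) (alpha beta : R) (G : sgraph) :
  two_walk_linear alpha beta G <->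
  ~ regular G /\ forall x : G,
    \sum_(y in neighbours x) (valency y)%:R =
      alpha * (valency x)%:R + beta :> R.
Proof.
(* Used with [F] constantly 1 for the valency vector, then with the valencies for its image. *)
have mulA (F : G -> R) (i : 'I_#|G|) :
    (adjmx R G *m \col_j F (enum_val j)) i 0 =
    \sum_(y in neighbours (enum_val i)) F y.
  rewrite mxE [RHS]big_mkcond /=.
  rewrite [RHS](reindex_onto enum_val enum_rank) /=; last first.
    by move=> y _; rewrite enum_rankK.
  apply: eq_big => [j|j _]; first by rewrite /= enum_valK eqxx.
  by rewrite !mxE inE; case: ifP => _; rewrite ?mul1r ?mul0r.
have vecE : valency_vec R G = \col_j (valency (enum_val j))%:R.
  have -> : valency_vec R G = adjmx R G *m \col_j 1.
    by congr (_ *m _); apply/matrixP => i j; rewrite !mxE.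
  by apply/matrixP => i j; rewrite ord1 (mulA (fun=> 1)) mxE sumr_const.
rewrite /two_walk_linear vecE; split=> -[nreg walk]; split=> //.
  move=> x; have := congr1 (fun M : 'cV_#|G| => M (enum_rank x) 0) walk.
  by rewrite (mulA (fun y => (valency y)%:R)) !mxE enum_rankK mulr1.
apply/matrixP => i j; rewrite ord1 (mulA (fun y => (valency y)%:R)) walk.
by rewrite !mxE mulr1.
Qed.

(** The difference of the two equations is [alpha] times the nonzero difference of row sums, and
    also [a + d] times it; cancelling gives [alpha], then either equation gives [beta]. *)
Lemma two_walk_linear_quotient (alpha beta a b c d : int) :
    a + b != c + d ->
    a * (a + b) + b * (c + d) = alpha * (a + b) + beta ->
    c * (a + b) + d * (c + d) = alpha * (c + d) + beta ->
  alpha = a + d /\ beta = b * c - a * d.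
Proof.
move=> neqk walk1 walk2; have alphaE : alpha = a + d.
  apply: (mulIf (x := a + b - (c + d))); first by rewrite subr_eq0.
  have := congr2 (fun u v => u - v) walk1 walk2; lia.
by split=> //; move: walk1; rewrite alphaE; lia.
Qed.

Lemma equitable_biregular_discr (R : realType) (alpha beta : int) (G : sgraph) :
    connected G -> equitable G -> biregular G ->
    two_walk_linear (alpha%:~R : R) (beta%:~R : R) G ->
  4 < alpha ^+ 2 + 4 * beta.
Proof.
move=> connG /equitableP eqG /biregularP[x1 [x2 [neq12 all12]]].
move=> /two_walk_linearP[_ walk].
(* At [x1] and [x2] these are the four entries of the quotient matrix. *)
pose n (x y : G) := #|neighbours x :&: valency_class G (valency y)|.
have valE x : valency x = (n x x1 + n x x2)%N.
  have := sum_neighbours_biregular (fun=> 1%N) x neq12 all12.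
  by rewrite sum1_card !mulr1 !natn.
have valZ x : (n x x1)%:Z + (n x x2)%:Z = (valency x)%:Z by rewrite -PoszD -valE.
have walkE x : ((n x x1)%:Z * (valency x1)%:Z + (n x x2)%:Z * (valency x2)%:Z
    = alpha * (valency x)%:Z + beta).
  apply: (intr_inj (R := R)); rewrite !(rmorphD, rmorphM) /= -!pmulrn.
  by rewrite -walk (sum_neighbours_biregular (fun k => k%:R) x neq12 all12).
have [neq21 all21] : valency x2 != valency x1 /\
    forall x : G, valency x = valency x2 \/ valency x = valency x1.
  by rewrite eq_sym; split=> // x; case: (all12 x); [right | left].
(* Some edge leaves the class of [u1]; equitability moves its starting point to [u1] itself. *)
have cross (u1 u2 : G) : valency u1 != valency u2 ->
    (forall x : G, valency x = valency u1 \/ valency x = valency u2) ->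
    (0 < n u1 u2)%N.
  move=> nequ allu; have [x [y [xy vx vy]]] := connected_class_edge connG nequ.
  rewrite /n (eqG u1 x) //; apply/card_gt0P; exists y; rewrite !inE xy /=.
  by case: (allu y) vy => ->; rewrite eqxx.
have := cross _ _ neq12 all12; have := cross _ _ neq21 all21.
have [] := @two_walk_linear_quotient alpha beta
             (n x1 x1) (n x1 x2) (n x2 x1) (n x2 x2).
- by rewrite !valZ eqz_nat.
- by rewrite !valZ walkE.
- by rewrite !valZ walkE.
move: neq12; rewrite !valE.
move: (n x1 x1) (n x1 x2) (n x2 x1) (n x2 x2) => a b c d neqk -> -> c0 b0.
have -> : (a%:Z + d%:Z) ^+ 2 + 4 * (b%:Z * c%:Z - a%:Z * d%:Z) =
  (a%:Z - d%:Z) ^+ 2 + 4 * (b * c)%N%:Z by rewrite PoszM; ring.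
have [bc_le1|bc_gt1] := leqP (b * c) 1.
  (* Here [neqk] reads [a + 1 != 1 + d], so the square is positive. *)
  have [b1 c1] : b = 1%N /\ c = 1%N by nia.
  have : 0 < (a%:Z - d%:Z) ^+ 2 by rewrite exprn_even_gt0 //=; lia.
  by rewrite b1 c1; lia.
by have := sqr_ge0 (a%:Z - d%:Z); lia.
Qed.

(** * The construction: a base graph with [m] copies hanging from it *)

Section PendantCopies.
Variables (T : finType) (e2 e1 : rel T) (d a m : nat).
Hypotheses (e2_sym : symmetric e2) (e2_irr : irreflexive e2).
Hypotheses (e1_sym : symmetric e1) (e1_irr : irreflexive e1).
Hypothesis e2_card : forall x, #|[set y | e2 x y]| = d.
Hypothesis e1_card : forall x, #|[set y | e1 x y]| = a.

(** [inl x] is a base vertex and [inr (x, i)] its twin in copy [i]. The quotient matrix is [[d, m],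
    [1, a]]. *)
Definition pendant_adj (u v : T + T * 'I_m) : bool :=
  match u, v with
  | inl x, inl y => e2 x y
  | inl x, inr q => x == q.1
  | inr p, inl y => p.1 == y
  | inr p, inr q => e1 p.1 q.1 && (p.2 == q.2)
  end.

Fact pendant_adj_sym : symmetric pendant_adj.
Proof.
move=> [x|[x i]] [y|[y j]] /=; first exact: e2_sym.
- by rewrite eq_sym.
- by rewrite eq_sym.
by rewrite e1_sym [i == j]eq_sym.
Qed.

Fact pendant_adj_irr : irreflexive pendant_adj.
Proof. by move=> [x|[x i]] /=; rewrite ?e2_irr ?e1_irr. Qed.

Definition pendant_graph := SGraph pendant_adj_sym pendant_adj_irr.
Implicit Types u v : pendant_graph.

(** One computation yields the valencies, the equitability counts and the walk sums, for suitable
    [F]. *)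
Lemma sum_neighbours_pendant (S : pzSemiRingType) (F : pendant_graph -> S)
    (f2 f1 : S) v :
    (forall x : T, F (inl x) = f2) -> (forall p : T * 'I_m, F (inr p) = f1) ->
  \sum_(w in neighbours v) F w =
    if v is inl _ then d%:R * f2 + m%:R * f1 else f2 + a%:R * f1.
Proof.
move=> Fl Fr; under eq_bigl do rewrite inE.
rewrite big_sumType /=.
under eq_bigr do rewrite Fl; under [X in _ + X]eq_bigr do rewrite Fr.
rewrite !sumr_const -(mulr_natl f2) -(mulr_natl f1).
case: v => [x|[x i]].
  congr (_%:R * _ + _%:R * _).
    by rewrite -(e2_card x); apply: eq_card => y; rewrite unfold_in !inE.
  transitivity #|setX [set x] [set: 'I_m]|; last first.
    by rewrite cardsX cards1 cardsT card_ord mul1n.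
  by apply: eq_card => -[y j]; rewrite unfold_in !inE andbT eq_sym.
rewrite -[in RHS](mul1r f2); congr (_ * _ + _%:R * _).
  by rewrite (eq_card1 (x := x)) // => y; rewrite unfold_in inE eq_sym.
transitivity #|setX [set y | e1 x y] [set i]|; last first.
  by rewrite cardsX cards1 e1_card muln1.
by apply: eq_card => -[y j]; rewrite unfold_in !inE /= [i == j]eq_sym.
Qed.

Lemma valency_pendant v :
  valency v = if v is inl _ then (d + m)%N else a.+1.
Proof.
rewrite /valency -sum1_card.
rewrite (@sum_neighbours_pendant nat (fun=> 1%N) 1 1) //.
by case: v => _; rewrite !mulr1 !natn.
Qed.

Hypothesis neq_valency : (d + m)%N != a.+1.
Hypothesis e2_connected : forall x y, connect e2 x y.

(** By [neq_valency], vertices of equal valency are both in the base or both in copies. *)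
Lemma equitable_pendant : equitable pendant_graph.
Proof.
apply/equitableP => v v' w vv'.
rewrite !card_neighbours_class !(@sum_neighbours_pendant nat
  (fun y => (valency y == valency w)%N)
  (d + m == valency w)%N (a.+1 == valency w)%N);
  try by move=> ?; rewrite valency_pendant.
move: vv' neq_valency; rewrite !valency_pendant.
by case: v v' => [?|?] [?|?] // ->; rewrite eqxx.
Qed.

(** [alpha] is the trace and [- beta] the determinant of [[d, m], [1, a]], so this is
    Cayley-Hamilton applied to the all-ones vector. *)
Lemma two_walk_linear_pendant (R : realType) (alpha beta : int) :
    inhabited T -> (0 < m)%N ->
    alpha = a%:Z + d%:Z -> beta = m%:Z - a%:Z * d%:Z ->
  two_walk_linear (alpha%:~R : R) (beta%:~R : R) pendant_graph.
Proof.
move=> [x0] m_gt0 -> ->; apply/two_walk_linearP; split.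
  move=> [k reg]; move: neq_valency.
  have := reg (inl x0); rewrite valency_pendant => ->.
  by have := reg (inr (x0, Ordinal m_gt0)); rewrite valency_pendant => ->;
    rewrite eqxx.
move=> v.
rewrite (@sum_neighbours_pendant R (fun y => (valency y)%:R)
  (d + m)%:R a.+1%:R); try by move=> ?; rewrite valency_pendant.
rewrite valency_pendant !(rmorphD, rmorphB, rmorphM) /= -!pmulrn.
by case: v => _; rewrite ?natrD -?natr1; ring.
Qed.

Lemma biregular_pendant :
  inhabited T -> (0 < m)%N -> biregular pendant_graph.
Proof.
move=> [x0] m_gt0; apply/biregularP.
exists (inl x0), (inr (x0, Ordinal m_gt0)); rewrite !valency_pendant.
by split=> // -[x|p]; rewrite valency_pendant; [left | right].
Qed.

(** Every vertex reaches the base in at most one step, and paths of [e2] lift to the base. *)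
Lemma connected_pendant : inhabited T -> connected pendant_graph.
Proof.
move=> [x0]; split; first by apply/card_gt0P; exists (inl x0).
have adj_csym := sym_connect_sym pendant_adj_sym.
have connl x y : connect pendant_adj (inl x) (inl y).
  have /connectP[p e2p ->] := e2_connected x y.
  elim: p x e2p => [|z p IHp] x /=; first by rewrite connect0.
  by case/andP=> xz /IHp; apply/connect_trans/connect1.
have to_base v : exists x, connect pendant_adj v (inl x).
  case: v => [x|p]; first by exists x; rewrite connect0.
  by exists p.1; apply: connect1 => /=.
move=> u v; have [[x ux] [y vy]] := (to_base u, to_base v).
apply: connect_trans ux (connect_trans (connl x y) _).
by rewrite adj_csym.
Qed.

Lemma pendant_example (R : realType) (alpha beta : int) :
    inhabited T -> (0 < m)%N ->
    alpha = a%:Z + d%:Z -> beta = m%:Z - a%:Z * d%:Z ->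
  exists G : sgraph,
    [/\ connected G, equitable G, biregular G
      & two_walk_linear (alpha%:~R : R) (beta%:~R : R) G].
Proof.
move=> Tinh m_gt0 alphaE betaE; exists pendant_graph; split.
- exact: connected_pendant.
- exact: equitable_pendant.
- exact: biregular_pendant.
- exact: two_walk_linear_pendant.
Qed.

End PendantCopies.

(** * Examples for even and odd [alpha], and the equivalence *)

Lemma even_example (R : realType) (alpha beta : int) (d m : nat) :
    (1 < m)%N -> alpha = d%:Z + d%:Z -> beta = m%:Z - d%:Z * d%:Z ->
  exists G : sgraph,
    [/\ connected G, equitable G, biregular G
      & two_walk_linear (alpha%:~R : R) (beta%:~R : R) G].
Proof.
move=> m_gt1 alphaE betaE.
pose e : rel 'I_d.+1 := [rel x y | x != y].
have e_sym : symmetric e by move=> x y; rewrite /e /= eq_sym.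
have e_irr : irreflexive e by move=> x; rewrite /e /= eqxx.
have e_card x : #|[set y | e x y]| = d.
  transitivity #|~: [set x]|; last by rewrite cardsC1 card_ord.
  by apply: eq_card => y; rewrite !inE /= eq_sym.
(* The valencies [d + m] and [d.+1] differ because [1 < m]. *)
apply: (@pendant_example _ e e d d m) => //; try by lia.
  move=> x y; have [->|xy] := eqVneq x y; first exact: connect0.
  exact: connect1.
by exists; exact: ord0.
Qed.

Lemma odd_example (R : realType) (alpha beta : int) (a m : nat) :
    (0 < m)%N -> alpha = a%:Z + a.+1%:Z -> beta = m%:Z - a%:Z * a.+1%:Z ->
  exists G : sgraph,
    [/\ connected G, equitable G, biregular G
      & two_walk_linear (alpha%:~R : R) (beta%:~R : R) G].
Proof.
move=> m_gt0 alphaE betaE.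
(* The boolean names the side of the bipartite graph, and also the clique in [e1]. *)
pose e2 : rel (bool * 'I_a.+1) := [rel x y | x.1 != y.1].
pose e1 : rel (bool * 'I_a.+1) := [rel x y | (x.1 == y.1) && (x.2 != y.2)].
apply: (@pendant_example _ e2 e1 a.+1 a m) => //.
- by move=> x y; rewrite /e1 /e2 /= eq_sym.
- by move=> x; rewrite /e1 /e2 /= eqxx.
- by move=> x y; rewrite /e1 /e2 /= eq_sym [x.2 == _]eq_sym.
- by move=> x; rewrite /e1 /e2 /= !eqxx.
- move=> [s x]; transitivity #|setX [set ~~ s] [set: 'I_a.+1]|.
    by apply: eq_card => -[t y]; rewrite !inE andbT /=; case: s t => [] [].
  by rewrite cardsX cards1 cardsT card_ord mul1n.
- move=> [s x]; transitivity #|setX [set s] (~: [set x])|.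
    by apply: eq_card => -[t y]; rewrite !inE /e1 /= [s == t]eq_sym [y == x]eq_sym.
  by rewrite cardsX cards1 cardsC1 card_ord mul1n.
- by rewrite neq_ltn; lia.
- move=> x y; have [xy|xy] := eqVneq x.1 y.1; last exact: connect1.
  (* Two vertices on one side are joined through the opposite side. *)
  by apply: (@connect_trans _ _ (~~ x.1, x.2)); apply: connect1;
    rewrite /e2 /= -?xy; case: x.1.
by exists; exact: (true, ord0).
Qed.

Theorem theorem2p4 (R : realType) (alpha beta : int) (halpha : 0 <= alpha) :
  (exists G : sgraph,
     [/\ connected G, equitable G, biregular G
       & two_walk_linear (alpha%:~R : R) (beta%:~R : R) G])
  <-> 4 < alpha ^+ 2 + 4 * beta.
Proof.
split=> [[G [connG eqG biregG walkG]]|].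
  exact: equitable_biregular_discr walkG.
case: alpha halpha => // n _ discr.
have := odd_double_half n; move: (n./2) => a; case: (odd n) => nE.
  (* Solving the formula for [beta] gives [m]. The discriminant is [4 * m + 1] here and [4 * m] in
     the even case, so exceeding 4 means [m >= 1], respectively [m >= 2]; [absz] therefore changes
     nothing. *)
  apply: (@odd_example R n beta a (absz (beta + a%:Z * a.+1%:Z))); nia.
apply: (@even_example R n beta a (absz (beta + a%:Z * a%:Z))); nia.
Qed.
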